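(* Suppose that a (strictly) stationary sequence $\{X_j\}$ of real random variables admits a regular phantom distribution function $G$. Let $H$ be any other phantom distribution function for $\{X_j\}$. Then $H$ is also regular, and $G$ and $H$ are strictly tail-equivalent. Conversely, if a distribution function $H$ is regular and strictly tail-equivalent to $G$, then $H$ is also a phantom distribution function for $\{X_j\}$.
   Context: $M_n=\max_{1\le j\le n}X_j$. A distribution function $G$ is a phantom distribution function for the stationary sequence $\{X_j\}$ if $\sup_{u\in\mathbb{R}}|\mathbb{P}(M_n\le u)-G^n(u)|\to 0$ as $n\to\infty$, where $G^n(u)=(G(u))^n$. For a distribution function $G$, its right end is $G_*=\sup\{x: G(x)<1\}$. $G$ is called regular (in the sense of O'Brien) if $G(G_*-)=1$ and $\lim_{x\to G_*-}\frac{1-G(x-)}{1-G(x)}=1$, where $G(x-)$ denotes the left limit at $x$. Two distribution functions $G$ and $H$ are strictly tail-equivalent if $G_*=H_*$ and $\frac{1-H(x)}{1-G(x)}\to 1$ as $x\to G_*-$. *)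

(* Defs.v *)
From HB Require Import structures.
From mathcomp Require Import all_boot all_order all_algebra.
From mathcomp Require Import all_classical all_reals all_analysis.
Set Implicit Arguments.
Unset Strict Implicit.
Unset Printing Implicit Defensive.
Import Order.TTheory GRing.Theory Num.Theory.
Import numFieldNormedType.Exports.
Local Open Scope classical_set_scope.
Local Open Scope ring_scope.

(* A distribution function on R is an element of [cumulativeBounded 0 1]:
   nondecreasing, right-continuous, with limits 0 at -oo and 1 at +oo.
   Random sequences are indexed from 0: [X j] stands for X_{j+1}. *)

Section random_sequences.
Context (d : measure_display) (T : measurableType d) (R : realType).
Context (P : probability T R).
Implicit Types (X : nat -> {RV P >-> R}) (G : cumulativeBounded (0 : R) (1 : R)).

(* Measurability in [k.-tuple R] is for the product sigma-algebra, so this says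
   that (X_1, ..., X_k) and (X_{h+1}, ..., X_{h+k}) have the same law. *)
Definition strictly_stationary X : Prop :=
  forall (k h : nat) (B : set (k.-tuple R)), measurable B ->
    P [set t | B [tuple X (h + i)%N t | i < k]] =
    P [set t | B [tuple X i t | i < k]].

(* M_n for n >= 1. For n = 0 it is [X 0], which does not affect limits in n. *)
Definition partial_max X (n : nat) (t : T) : R :=
  \big[Num.max/X 0%N t]_(j < n) X j t.

Definition phantom_df X G : Prop :=
  ereal_sup [set `|P [set t | (partial_max X n t <= u)%R] - (G u ^+ n)%:E|%E
            | u in [set: R]] @[n --> \oo] --> 0%E.

End random_sequences.

Section distribution_functions.
Context (R : realType).
Implicit Types G H : cumulativeBounded (0 : R) (1 : R).

Definition right_end G : \bar R := ereal_sup [set x%:E | x in [set x | G x < 1]].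

(* The filter x -> a- on R, for an extended real a. The case a = -oo never
   arises as the right end of a distribution function, which is < 1 near -oo. *)
Definition left_nbhs (a : \bar R) : set_system R :=
  match a with
  | r%:E => r^'-
  | +oo%E => pinfty_nbhs R
  | -oo%E => globally set0
  end.

Definition left_lim G (x : R) : R := lim (G y @[y --> x^'-]).

Definition regular_df G : Prop :=
  (G x @[x --> left_nbhs (right_end G)] --> (1 : R)) /\
  ((1 - left_lim G x) / (1 - G x) @[x --> left_nbhs (right_end G)] --> (1 : R)).

Definition strictly_tail_equivalent G H : Prop :=
  right_end G = right_end H /\
  ((1 - H x) / (1 - G x) @[x --> left_nbhs (right_end G)] --> (1 : R)).

End distribution_functions.

(* Main.v *)
(* Since P(M_n <= u) is uniformly close to G(u)^n, a distribution function H is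
   phantom iff G^n - H^n tends to 0 uniformly; the probability space plays no
   further role. If 1 - H = (1 + o(1)) (1 - G) near the right end, the mean
   value bound |a^n - b^n| <= n |a - b| max(a, b)^(n-1) together with
   n s (1 - s)^(n-1) <= 1 - (1 - s)^n <= 1 makes G^n - H^n uniformly small there,
   and to the left of any point below the right end both powers vanish.
   Conversely, given x near the right end, one takes n of order 1 / (1 - G(x));
   by Bernoulli's inequality a relative discrepancy e between 1 - G(x) and
   1 - H(x) forces |G(x)^n - H(x)^n| >= e / 16. Regularity of H follows from that
   of G by passing to left limits in the tail comparison. *)
Require Import Defs.
From HB Require Import structures.
From mathcomp Require Import all_boot all_order all_algebra.
From mathcomp Require Import all_classical all_reals all_analysis.
From mathcomp Require Import ring lra.
Set Implicit Arguments.
Unset Strict Implicit.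
Unset Printing Implicit Defensive.
Import Order.TTheory GRing.Theory Num.Theory.
Import numFieldNormedType.Exports.
Local Open Scope classical_set_scope.
Local Open Scope ring_scope.

(** * Elementary inequalities for powers on the unit interval *)

Lemma expr_diff_bounds (R : realFieldType) (s t : R) (n : nat) :
  0 <= s -> s <= t ->
  n%:R * (t - s) * s ^+ n.-1 <= t ^+ n - s ^+ n <= n%:R * (t - s) * t ^+ n.-1.
Proof.
move=> s0 st; have t0 : 0 <= t by apply: le_trans st.
have sumE (c : R) : n%:R * c = \sum_(i < n) c.
  by rewrite sumr_const card_ord mulr_natl.
have splitE (c : R) (i : 'I_n) : c ^+ n.-1 = c ^+ (n.-1 - i) * c ^+ i.
  by rewrite -exprD subnK// -ltnS prednK ?(leq_ltn_trans _ (ltn_ord i)).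
(* Each of the [n] terms [t ^+ (n.-1 - i) * s ^+ i] of the factorization lies between [s ^+ n.-1]
   and [t ^+ n.-1]. *)
rewrite subrXX ![n%:R * _]mulrC -!mulrA !sumE; apply/andP; split.
all: apply: ler_wpM2l; rewrite ?subr_ge0//; apply: ler_sum => i _.
all: by rewrite (splitE _ i) ler_pM ?exprn_ge0// lerXn2r ?nnegrE.
Qed.

Lemma bernoulli_le (R : realFieldType) (s : R) (n : nat) :
  0 <= s <= 1 -> 1 - n%:R * (1 - s) <= s ^+ n.
Proof.
move=> /andP[s0 s1]; have /andP[_] := expr_diff_bounds n s0 s1.
by rewrite !expr1n mulr1; lra.
Qed.

(** The factor 2 pays for measuring the gap against [1 - a]: when [a < b], the bound [e <= 1/2]
    gives [1 - a <= 2 * (1 - b)], so the gap is always at most [2 * e] times the distance from 1 to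
    the larger number. *)
Lemma expr_close (R : realFieldType) (a b e : R) (n : nat) :
  0 <= a <= 1 -> 0 <= b <= 1 -> 0 <= e <= 2^-1 ->
  `|a - b| <= e * (1 - a) -> `|a ^+ n - b ^+ n| <= 2 * e.
Proof.
move=> /andP[a0 a1] /andP[b0 b1] /andP[e0 e2].
have key (s t c : R) : 0 <= s -> s <= t -> t <= 1 -> 0 <= c ->
    t - s <= c * (1 - t) -> t ^+ n - s ^+ n <= c.
  move=> s0 st t1 c0 h; have t0 := le_trans s0 st.
  have /andP[_ ub] := expr_diff_bounds n s0 st.
  have /andP[lb _] := expr_diff_bounds n t0 t1.
  apply: le_trans ub _.
  have w0 : 0 <= t ^+ n.-1 by apply: exprn_ge0.
  have : n%:R * (t - s) * t ^+ n.-1 <= c * (n%:R * (1 - t) * t ^+ n.-1).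
    rewrite (_ : c * _ = n%:R * (c * (1 - t)) * t ^+ n.-1); last by ring.
    by rewrite ler_wpM2r// ler_wpM2l.
  move=> /le_trans; apply; rewrite -[leRHS]mulr1 ler_wpM2l//.
  by apply: le_trans lb _; rewrite expr1n gerBl exprn_ge0.
case: (leP b a) => ab.
  rewrite !ger0_norm ?subr_ge0// ?lerXn2r// => h.
  by apply: (key b a) => //; nra.
have {}ab := ltW ab.
rewrite !ler0_norm ?subr_le0 ?lerXn2r// !opprB => h.
by apply: (key a b) => //; nra.
Qed.

Lemma close_of_expr (R : realFieldType) (a b e : R) (n : nat) :
  0 <= b -> 0 < e <= 1 -> 0 <= a < 1 ->
  8^-1 <= n%:R * (1 - a) <= 4^-1 ->
  `|a ^+ n - b ^+ n| < e / 16 -> `|a - b| <= e * (1 - a).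
Proof.
move=> b0 /andP[e0 e1] /andP[a0 a1] /andP[nq1 nq2] h.
have n0 : 0 < n%:R :> R by nra.
have n1 : 1 <= n%:R :> R by rewrite ler1n -(ltr0n R).
(* Here [n * (1 - s) <= 1/2], so Bernoulli gives [s ^+ n >= 1/2], while [n * (t - s) >= e / 8]; the
   product yields [e / 16]. *)
have key (s t : R) : 1 - 2 * (1 - a) <= s -> s <= 1 -> s <= t ->
    e * (1 - a) <= t - s -> e / 16 <= t ^+ n - s ^+ n.
  move=> s2 s1 st gap.
  have s0 : 0 <= s by nra.
  have /andP[lb _] := expr_diff_bounds n s0 st.
  apply: le_trans lb.
  have p2 : 2^-1 <= s ^+ n.
    have := @bernoulli_le _ s n; rewrite s0 s1 => /(_ isT); nra.
  have {}p2 : 2^-1 <= s ^+ n.-1.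
    by apply: le_trans p2 _; rewrite ler_wiXn2l// leq_pred.
  have : e / 8 <= n%:R * (t - s) by nra.
  by move=> ?; nra.
rewrite leNgt; apply/negP; rewrite lter_normr => /orP[]g; last first.
  have : e / 16 <= b ^+ n - a ^+ n by apply: key; nra.
  by apply/negP; rewrite -ltNge (le_lt_trans (ler_norm _))// distrC.
(* [b] may lie too far below [a] for Bernoulli. Raising it to [a - e * (1 - a)] only shrinks the
   difference of powers. *)
have : e / 16 <= a ^+ n - (a - e * (1 - a)) ^+ n by apply: key; nra.
apply/negP; rewrite -ltNge; apply: le_lt_trans h.
apply: le_trans (ler_norm _); rewrite lerB// lerXn2r ?nnegrE//; last lra.
by apply: le_trans b0 _; lra.
Qed.

(** Clearing the denominator leaves a non-strict inequality, which survives passage to left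
    limits. *)
Lemma ratio_cvg1P (R : realFieldType) (T : Type) (F : set_system T)
    (f g : T -> R) : Filter F -> (\forall x \near F, 0 < g x) ->
  (f x / g x @[x --> F] --> (1 : R)) <->
  (forall e, 0 < e -> \forall x \near F, `|g x - f x| <= e * g x).
Proof.
move=> FF g0.
have normE x e : 0 < g x -> (`|1 - f x / g x| <= e) = (`|g x - f x| <= e * g x).
  move=> gx0; rewrite -{1}(divff (lt0r_neq0 gx0)) -mulrBl normrM normfV.
  by rewrite (gtr0_norm gx0) ler_pdivrMr.
split=> [/cvgrPdist_le h e e0|h].
  apply: filterS2 g0 (h e e0) => x gx0.
  by rewrite normE.
apply/cvgrPdist_le => e e0.
by apply: filterS2 g0 (h e e0) => x gx0; rewrite normE.
Qed.

(** * Distribution functions, their right ends and left limits *)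

Section distribution_function_facts.
Context (R : realType).
Implicit Types G H : cumulativeBounded (0 : R) (1 : R).

Lemma df_le G (x y : R) : x <= y -> G x <= G y.
Proof. exact: cumulative_is_nondecreasing. Qed.

Lemma df_ge0 G (x : R) : 0 <= G x.
Proof.
have := cumulativeNy G => /cvgrPdist_lt FG.
rewrite leNgt; apply/negP => Gx0.
have /FG [M [_ HM]] : 0 < - G x by rewrite oppr_gt0.
have /= := HM (Num.min (M - 1) x); rewrite gt_min ltrBlDr ltrDl ltr01 => /(_ isT).
rewrite sub0r normrN ltNge => /negP; apply.
have := @df_le G (Num.min (M - 1) x) x; rewrite ge_min lexx orbT => /(_ isT) Gm.
by rewrite ler0_norm ?lerN2// (le_trans Gm)// ltW.
Qed.

Lemma df_le1 G (x : R) : G x <= 1.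
Proof.
have := cumulativey G => /cvgrPdist_lt FG.
rewrite leNgt; apply/negP => Gx1.
have /FG [M [_ HM]] : 0 < G x - 1 by rewrite subr_gt0.
have /= := HM (Num.max (M + 1) x); rewrite lt_max ltrDl ltr01 => /(_ isT).
have := @df_le G x (Num.max (M + 1) x); rewrite le_max lexx orbT => /(_ isT) Gm.
by rewrite ltr0_norm; lra.
Qed.

(** By right continuity [G] stays below 1 slightly to the right of any point where it is below 1, so
    the supremum is not attained. *)
Lemma lt_right_endP G (x : R) : (x%:E < right_end G)%E <-> G x < 1.
Proof.
split=> [/ereal_sup_gt[_ [y /= Gy <-]]|Gx].
  by rewrite lte_fin => /ltW/(df_le G)/le_lt_trans; apply.
have e0 : 0 < (1 - G x) / 2 by lra.
have [d Gd] : exists d : {posnum R}, G (x + d%:num) <= G x + (1 - G x) / 2.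
  exact: nondecreasing_right_continuousP.
have : ((x + d%:num)%:E <= right_end G)%E.
  by apply: ereal_sup_ubound; exists (x + d%:num) => //=; lra.
by apply: lt_le_trans; rewrite lte_fin ltrDl.
Qed.

Lemma right_end_neqNy G : right_end G != -oo%E.
Proof.
have /cvgrPdist_lt/(_ 1 ltr01)[M [_ HM]] := cumulativeNy G.
have /= := HM (M - 1); rewrite ltrBlDr ltrDl ltr01 => /(_ isT).
rewrite sub0r normrN ger0_norm ?df_ge0// => /lt_right_endP.
by apply: contraTneq => ->; rewrite ltNge leNye.
Qed.

(** Treats finite and infinite right ends uniformly. *)
Lemma left_nbhsP (a : \bar R) (Q : set R) : a != -oo%E ->
  left_nbhs a Q <->
  exists2 x0, (x0%:E < a)%E & forall x, x0 < x -> (x%:E < a)%E -> Q x.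
Proof.
case: a => [r| |]//= _; split.
- move=> [e /= e0 h]; exists (r - e); first by rewrite lte_fin; lra.
  move=> x x0; rewrite lte_fin => xr; apply: h => //=.
  by rewrite ger0_norm; lra.
- move=> [x0]; rewrite lte_fin => x0r h.
  near=> x; apply: h; first by near: x; exact: nbhs_left_gt.
  by rewrite lte_fin; near: x; exact: nbhs_left_lt.
- by move=> [M [_ h]]; exists M; rewrite ?ltry// => x Mx _; apply: h.
- move=> [x0 _ h]; exists x0; split; first exact: num_real.
  by move=> x x0x; apply: h; rewrite ?ltry.
Unshelve. all: by end_near. Qed.

#[local] Instance left_nbhs_filter (a : \bar R) : Filter (left_nbhs a).
Proof. by case: a => [r| |] /=; exact: _. Qed.

Lemma left_nbhs_right_end_lt1 G :
  \forall x \near left_nbhs (right_end G), G x < 1.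
Proof.
have := right_end_neqNy G; case E : (right_end G) => [r| |]// _.
all: apply/left_nbhsP => //.
  by exists (r - 1) => [|x _]; [rewrite lte_fin; lra|rewrite -E => /lt_right_endP].
by exists 0 => [|x _]; [rewrite ltry|rewrite -E => /lt_right_endP].
Qed.

(** [lim] has a default value without convergence; monotonicity and boundedness make [left_lim] a
    genuine limit. *)
Lemma left_lim_cvg G (x : R) : cvg (G y @[y --> x^'-]).
Proof.
apply: nondecreasing_at_left_is_cvgr; near=> z.
  by move=> u v _ _; exact: df_le.
by exists 1 => _ [y _ <-]; exact: df_le1.
Unshelve. all: by end_near. Qed.

Lemma left_lim_le G (x : R) : left_lim G x <= G x.
Proof.
apply: limr_le; first exact: left_lim_cvg.
near=> y; apply: df_le; apply: ltW; near: y; exact: nbhs_left_lt.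
Unshelve. all: by end_near. Qed.

(** * Tail comparison as a relative error *)

Definition tail_close G H : Prop := forall e : R, 0 < e ->
  \forall x \near left_nbhs (right_end G), `|G x - H x| <= e * (1 - G x).

Lemma tail_closeP G H : tail_close G H <->
  ((1 - H x) / (1 - G x) @[x --> left_nbhs (right_end G)] --> (1 : R)).
Proof.
have G1 : \forall x \near left_nbhs (right_end G), 0 < 1 - G x.
  by apply: filterS (left_nbhs_right_end_lt1 G) => x; rewrite subr_gt0.
rewrite (ratio_cvg1P _ _ G1); split=> h e /h; apply: filterS => x.
all: by rewrite (_ : 1 - G x - (1 - H x) = H x - G x) 1?distrC//; ring.
Qed.

Lemma regular_dfP G : regular_df G <->
  (G x @[x --> left_nbhs (right_end G)] --> (1 : R)) /\
  (forall e : R, 0 < e -> \forall x \near left_nbhs (right_end G),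
     G x - left_lim G x <= e * (1 - G x)).
Proof.
have G1 : \forall x \near left_nbhs (right_end G), 0 < 1 - G x.
  by apply: filterS (left_nbhs_right_end_lt1 G) => x; rewrite subr_gt0.
rewrite /regular_df (ratio_cvg1P _ _ G1).
have E x : `|1 - G x - (1 - left_lim G x)| = G x - left_lim G x.
  rewrite -[RHS]ger0_norm ?subr_ge0 ?left_lim_le// -[RHS]normrN.
  by congr `| _ |; ring.
by split=> -[Gl h]; split=> // e /h; apply: filterS => x; rewrite E.
Qed.

Lemma df_lt1_right_end G H (x : R) :
  right_end G = right_end H -> (H x < 1) = (G x < 1).
Proof.
move=> E; apply/idP/idP => /lt_right_endP h; apply/lt_right_endP;
  by rewrite ?E// -E.
Qed.

(** The tail bound holds on a whole interval up to the right end, hence at all [y] slightly left of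
    [x]; let [y] tend to [x]. *)
Lemma tail_close_left_lim G H : tail_close G H -> forall e, 0 < e ->
  \forall x \near left_nbhs (right_end G),
    `|left_lim G x - left_lim H x| <= e * (1 - left_lim G x).
Proof.
move=> GH e e0; have /left_nbhsP := GH e e0.
move=> /(_ (right_end_neqNy G))[x0 x0G h].
apply/left_nbhsP; first exact: right_end_neqNy.
exists x0 => // x x0x xG.
have cG : cvg (G y @[y --> x^'-]) := @left_lim_cvg G x.
have cH : cvg (H y @[y --> x^'-]) := @left_lim_cvg H x.
have : `|G y - H y| @[y --> x^'-] --> `|left_lim G x - left_lim H x|.
  by apply: cvg_norm; exact: cvgB.
have : e * (1 - G y) @[y --> x^'-] --> e * (1 - left_lim G x).
  by apply: cvgMr; apply: cvgB => //; exact: cvg_cst.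
move=> c1 c2; rewrite -(cvg_lim _ c1)// -(cvg_lim _ c2)//.
apply: ler_lim; [by apply/cvg_ex; eexists; exact: c2|
                 by apply/cvg_ex; eexists; exact: c1|].
near=> y; apply: h; first by near: y; exact: nbhs_left_gt.
apply: lt_trans xG; rewrite lte_fin; near: y; exact: nbhs_left_lt.
Unshelve. all: by end_near. Qed.

Lemma tail_close_cvg1 G H : tail_close G H ->
  G x @[x --> left_nbhs (right_end G)] --> (1 : R) ->
  H x @[x --> left_nbhs (right_end G)] --> (1 : R).
Proof.
move=> GH /cvgrPdist_le G1; apply/cvgrPdist_le => e e0.
have e2 : 0 < e / 2 by lra.
apply: filterS2 (GH 1 ltr01) (G1 _ e2) => x.
rewrite mul1r !ler_norml; have := df_le1 G x; lra.
Qed.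

(** Relative error 1/2 forces [H y < 1] wherever [G y < 1] near the right end. Conversely, if
    [H x < 1] but [G x >= 1], every point below the right end of [G] is at most [x], so [H] is
    bounded there by [H x], against its limit 1. *)
Lemma tail_close_right_end G H : tail_close G H ->
  G x @[x --> left_nbhs (right_end G)] --> (1 : R) ->
  right_end G = right_end H.
Proof.
move=> GH G1; have H1 := tail_close_cvg1 GH G1.
have half0 : (0 : R) < 2^-1 by lra.
rewrite /right_end; congr (ereal_sup (_ @` _)); apply/seteqP; split=> x /= xlt.
- have /left_nbhsP := GH _ half0.
  move=> /(_ (right_end_neqNy G))[x0 x0G h].
  have [y [xy x0y yG]] : exists y, [/\ x <= y, x0 < y & (y%:E < right_end G)%E].
    have /lt_right_endP xG := xlt.
    have : ((Num.max x x0)%:E < right_end G)%E.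
      by rewrite EFin_max gt_max xG x0G.
    move=> /ereal_sup_gt[_ [y /= Gy <-]]; rewrite lte_fin gt_max => /andP[xy x0y].
    by exists y; split=> //; [exact: ltW|exact/lt_right_endP].
  apply: le_lt_trans (df_le H xy) _.
  have := h y x0y yG; rewrite ler_norml => /andP[+ _].
  by move/lt_right_endP : yG; lra.
- rewrite ltNge; apply/negP => Gx1.
  have Gx x' : (x'%:E < right_end G)%E -> x' <= x.
    move=> /lt_right_endP Gx'; rewrite leNgt; apply/negP => /ltW/(df_le G); lra.
  have e0 : 0 < (1 - H x) / 2 by lra.
  have /cvgrPdist_le/(_ _ e0)/left_nbhsP := H1.
  move=> /(_ (right_end_neqNy G))[x0 x0G h].
  have [_ [y /= Gy <-]] := ereal_sup_gt x0G; rewrite lte_fin => x0y.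
  move/lt_right_endP in Gy; have := h y x0y Gy.
  by have := df_le H (Gx _ Gy); rewrite ler_norml; lra.
Qed.

Lemma tail_close_regular G H : tail_close G H -> regular_df G -> regular_df H.
Proof.
move=> GH /regular_dfP[G1 Gl]; have E := tail_close_right_end GH G1.
apply/regular_dfP; rewrite -E; split; first exact: tail_close_cvg1 GH G1.
(* Split the jump of [H] as [(H - G) + (G - G-) + (G- - H-)]. The three errors total at most
   [4 * c * (1 - G x)], and [1 - G x <= 2 * (1 - H x)], whence [e / 8]. *)
move=> e e0; pose c := Num.min (e / 8) 8^-1.
have c0 : 0 < c by rewrite lt_min; lra.
have [ce c8] : c <= e / 8 /\ c <= 8^-1 by rewrite !ge_min !lexx orbT.
apply: filterS3 (Gl c c0) (GH c c0) (tail_close_left_lim GH c0) => x h1.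
have Gx := df_le1 G x.
rewrite !ler_norml => /andP[h2 h2'] /andP[h3 h3'].
set a := G x in h1 Gx h2 h2' h3 h3' *.
have h4 : 1 - left_lim G x <= 2 * (1 - a) by nra.
have h5 : 1 - a <= 2 * (1 - H x) by nra.
have h6 : c * (1 - left_lim G x) <= c * (2 * (1 - a)) by nra.
have h7 : c * (1 - a) <= e / 8 * (2 * (1 - H x)) by nra.
lra.
Qed.

(** * Tail comparison against uniform closeness of powers *)

Definition powers_close G H : Prop := forall e : R, 0 < e ->
  \forall n \near \oo, forall u, `|G u ^+ n - H u ^+ n| <= e.

(** The line is cut at a point [x1] and at the common right end: geometric decay on the left,
    [expr_close] in the middle, and both functions equal to 1 on the right. *)
Lemma tail_close_powers G H : right_end G = right_end H ->
  tail_close G H -> powers_close G H.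
Proof.
move=> E GH e e0; pose c := Num.min (e / 2) 2^-1.
have c0 : 0 < c by rewrite lt_min; lra.
have [ce c2] : c <= e / 2 /\ c <= 2^-1 by rewrite !ge_min !lexx orbT.
have /left_nbhsP := GH _ c0.
move=> /(_ (right_end_neqNy G))[x0 x0G h].
have [_ [x1 /= Gx1 <-]] := ereal_sup_gt x0G; rewrite lte_fin => x01.
have Hx1 : H x1 < 1 by rewrite (df_lt1_right_end _ E).
have small (K : cumulativeBounded (0 : R) (1 : R)) : K x1 < 1 ->
    \forall n \near \oo, forall u, u <= x1 -> K u ^+ n <= e.
  move=> K1; have /cvg_expr/cvgrPdist_le : `|K x1| < 1.
    by rewrite ger0_norm ?df_ge0.
  move=> /(_ e e0); apply: filterS => n; rewrite sub0r normrN.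
  move=> hn u ux; apply: le_trans hn.
  rewrite ger0_norm ?exprn_ge0 ?df_ge0// lerXn2r ?nnegrE ?df_ge0//.
  exact: df_le.
apply: filterS2 (small G Gx1) (small H Hx1) => n hG hH u.
have Gn := df_ge0 G u; have Hn := df_ge0 H u.
have G1 := df_le1 G u; have H1 := df_le1 H u.
have [ux|xu] := leP u x1.
  have := hG u ux; have := hH u ux.
  have := exprn_ge0 n Gn; have := exprn_ge0 n Hn.
  by rewrite ler_norml; lra.
have [Gu|Gu] := ltP (G u) 1.
  have := h u (lt_trans x01 xu); rewrite (lt_right_endP G u).
  move=> /(_ Gu) /(expr_close n); rewrite !df_ge0 !df_le1 => hc.
  by apply: le_trans (hc isT isT _) _; [apply/andP; split; lra|lra].
have -> : G u = 1 by apply/eqP; rewrite eq_le G1.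
have -> : H u = 1.
  by apply/eqP; rewrite eq_le H1 leNgt (df_lt1_right_end _ E) -leNgt.
by rewrite subrr normr0 ltW.
Qed.

(* [n] is chosen so that [n * (1 - G x)] lies between 1/8 and 1/4: then
   [G x ^+ n] stays away from 0 and 1 and detects relative changes of the tail. *)
Lemma powers_close_tail G H : powers_close G H ->
  G x @[x --> left_nbhs (right_end G)] --> (1 : R) -> tail_close G H.
Proof.
move=> GH /cvgrPdist_le G1 e e0; pose c := Num.min e 1.
have c0 : 0 < c by rewrite lt_min; lra.
have [ce c1] : c <= e /\ c <= 1 by rewrite !ge_min !lexx orbT.
(* Half of [c / 16], since [close_of_expr] asks for a strict bound. *)
have c32 : 0 < c / 32 by lra.
have [N _ hN] := GH _ c32.
(* Such a small tail [q] makes [N.+1 * q <= 1/8], which later forces [N <= n]. *)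
have q0 : 0 < (8 * N.+1%:R)^-1 :> R by rewrite invr_gt0 mulr_gt0.
apply: filterS2 (G1 _ q0) (left_nbhs_right_end_lt1 G) => x + Gx.
rewrite ger0_norm ?subr_ge0 ?df_le1//; set q := 1 - G x => qN.
have qp : 0 < q by rewrite subr_gt0.
(* Truncation gives [n * q <= 1/4 < (n + 1) * q], and [q <= 1/8] then leaves [n * q >= 1/8]. *)
pose n := Num.trunc ((4 * q)^-1).
have v0 : 0 < (4 * q)^-1 by rewrite invr_gt0; lra.
have /andP[n1 n2] := truncn_itv (ltW v0).
rewrite -/n in n1 n2.
have vq : (4 * q)^-1 * q = 4^-1.
  by rewrite invfM -mulrA mulVf ?mulr1// gt_eqF.
have qN1 : q * N.+1%:R <= 8^-1.
  by rewrite -ler_pdivlMr// -invfM.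
have N1 : 1 <= N.+1%:R :> R by rewrite ler1n.
have q8 : q <= 8^-1 by nra.
rewrite -[n.+1]addn1 natrD in n2.
have nq1 : 8^-1 <= n%:R * q by nra.
have nq2 : n%:R * q <= 4^-1 by nra.
have Nn : (N <= n)%N.
  rewrite -(ler_nat R); rewrite -[N.+1]addn1 natrD in qN1; nra.
apply: le_trans (_ : c * q <= _); last by rewrite ler_wpM2r// ltW.
apply: (close_of_expr (n := n)); rewrite ?df_ge0 ?c0 ?c1 ?Gx ?nq1 ?nq2//.
by apply: le_lt_trans (hN n Nn x) _; lra.
Qed.

End distribution_function_facts.

(** * From phantom distribution functions to closeness of powers *)

Section phantom_distribution_functions.
Context (d : measure_display) (T : measurableType d) (R : realType).
Context (P : probability T R) (X : nat -> {RV P >-> R}).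
Implicit Types G H : cumulativeBounded (0 : R) (1 : R).

(** The supremum lives in the extended reals; the bound for [e = 1] makes it eventually finite, so
    that convergence can be tested on real values. *)
Lemma phantom_dfP G : phantom_df X G <-> forall e : R, 0 < e ->
  \forall n \near \oo, forall u,
    (`|P [set t | (partial_max X n t <= u)%R] - (G u ^+ n)%:E| <= e%:E)%E.
Proof.
pose S n : \bar R := ereal_sup
  [set `|P [set t | (partial_max X n t <= u)%R] - (G u ^+ n)%:E|%E
  | u in [set: R]].
have S0 n : (0 <= S n)%E.
  apply: le_trans (ereal_sup_ubound _); last by exists 0.
  exact: abse_ge0.
split=> [|h].
  move=> /fine_cvgP[Sfin /cvgrPdist_le hS] e e0.
  apply: filterS2 Sfin (hS e e0) => n Sn.
  rewrite sub0r normrN ger0_norm ?fine_ge0//; last exact: S0.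
  rewrite -lee_fin fineK// => Se u; apply: le_trans Se.
  by apply: ereal_sup_ubound; exists u.
have Sle e : 0 < e -> \forall n \near \oo, (S n <= e%:E)%E.
  move=> /h; apply: filterS => n hn; apply: ge_ereal_sup => _ [u _ <-].
  exact: hn.
have Sfin n e : (S n <= e%:E)%E -> S n \is a fin_num.
  by move=> Se; rewrite ge0_fin_numE// (le_lt_trans Se)// ltry.
apply/fine_cvgP; split; first by apply: filterS (Sle 1 ltr01) => n; exact: Sfin.
apply/cvgrPdist_le => e /Sle; apply: filterS => n Se.
rewrite sub0r normrN ger0_norm ?fine_ge0//; last exact: S0.
by rewrite -lee_fin fineK// (Sfin n e).
Qed.

Lemma phantom_powers_close G H :
  phantom_df X G -> phantom_df X H -> powers_close G H.
Proof.
move=> /phantom_dfP hG /phantom_dfP hH e e0.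
have e2 : 0 < e / 2 by lra.
apply: filterS2 (hG _ e2) (hH _ e2) => n + + u => /(_ u) + /(_ u).
(* An infinite value would turn the bounds into [+oo <= e / 2], false by computation. *)
case: (P _) => [p| |]//; rewrite -!EFinB !abse_EFin !lee_fin !ler_norml; lra.
Qed.

Lemma powers_close_phantom G H :
  phantom_df X G -> powers_close G H -> phantom_df X H.
Proof.
move=> /phantom_dfP hG GH; apply/phantom_dfP => e e0.
have e2 : 0 < e / 2 by lra.
apply: filterS2 (hG _ e2) (GH _ e2) => n + + u => /(_ u) + /(_ u).
case: (P _) => [p| |]//; rewrite -!EFinB !abse_EFin !lee_fin !ler_norml; lra.
Qed.

End phantom_distribution_functions.

Theorem theorem2p2 (d : measure_display) (T : measurableType d) (R : realType)
    (P : probability T R) (X : nat -> {RV P >-> R})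
    (G : cumulativeBounded (0 : R) (1 : R)) :
  strictly_stationary X ->
  phantom_df X G ->
  regular_df G ->
  (forall H : cumulativeBounded (0 : R) (1 : R),
     phantom_df X H -> regular_df H /\ strictly_tail_equivalent G H) /\
  (forall H : cumulativeBounded (0 : R) (1 : R),
     regular_df H -> strictly_tail_equivalent G H -> phantom_df X H).
Proof.
move=> _ pG rG; split=> H.
  move=> pH; have [G1 _] := rG.
  have GH := powers_close_tail (phantom_powers_close pG pH) G1.
  split; first exact: tail_close_regular GH rG.
  by split; [exact: tail_close_right_end GH G1|exact/tail_closeP].
move=> _ [E /tail_closeP GH].
exact: powers_close_phantom pG (tail_close_powers E GH).
Qed.
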